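(* For any graph $G$, $$Z_G(X,-1)=\phi_{chr}(G),\qquad Z_G(X,0)=\phi_0(G),\qquad \phi_{chr}(G)=(-1)^{|V(G)|+\mathrm{cc}(G)} X^{\mathrm{cc}(G)}\,T_G(1-X,0).$$
   Context: $\mathbb{K}$ is a commutative field of characteristic $0$. Graphs are finite and simple: $G=(V(G),E(G))$ with $E(G)$ a set of unordered pairs of distinct vertices; the empty graph is allowed. $\mathrm{cc}(G)$ is the number of connected components of $G$. For $F\subseteq E(G)$, $G_{\mid F}$ is the graph with vertex set $V(G)$ and edge set $F$. The Fortuin-Kasteleyn polynomial is $Z_G(X,Y)=\sum_{F\subseteq E(G)} X^{\mathrm{cc}(G_{\mid F})}Y^{|F|}\in\mathbb{K}[X,Y]$. The Tutte polynomial is $T_G(X,Y)=\sum_{F\subseteq E(G)} (X-1)^{\mathrm{cc}(G_{\mid F})-\mathrm{cc}(G)} (Y-1)^{\mathrm{cc}(G_{\mid F})+|F|-|V(G)|}\in\mathbb{K}[X,Y]$. $\phi_{chr}(G)\in\mathbb{K}[X]$ is the chromatic polynomial of $G$ (the polynomial whose value at each $k\in\mathbb{N}$ is the number of proper colorings $V(G)\to\{1,\ldots,k\}$) and $\phi_0(G)=X^{|V(G)|}$. *)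

(* Defs.v *)
From mathcomp Require Import all_boot all_order all_algebra.

Set Implicit Arguments.
Unset Strict Implicit.
Unset Printing Implicit Defensive.

Import GRing.Theory.
Local Open Scope ring_scope.

Record graph := Graph {
  vertex :> finType;
  edges : {set {set vertex}};
  edges_card2 : forall e, e \in edges -> #|e| = 2%N
}.

Definition adj (G : graph) : rel G := fun x y => [set x; y] \in edges G.

Definition cc (G : graph) : nat := n_comp (@adj G) G.

Lemma restrict_card2 (G : graph) (F : {set {set G}}) e :
  e \in edges G :&: F -> #|e| = 2%N.
Proof. by case/setIP=> /edges_card2. Qed.

(* The intersection makes this total in F; it is only used for
   F \subset edges G, where the edge set is F itself. *)
Definition restrict (G : graph) (F : {set {set G}}) : graph :=
  Graph (@restrict_card2 G F).

(* K[X, Y] is represented as {poly {poly K}}: the inner variable is X and the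
   outer one is Y. *)
Definition indetX (K : nzRingType) : {poly {poly K}} := 'X%:P.
Definition indetY (K : nzRingType) : {poly {poly K}} := 'X.

(* P(a, b) for a, b in K[X] *)
Definition subst2 (K : nzRingType) (P : {poly {poly K}}) (a b : {poly K}) :
  {poly K} := (map_poly (fun q => q \Po a) P).[b].

Section Polynomials.
Variable K : fieldType.

Definition fortuin_kasteleyn (G : graph) : {poly {poly K}} :=
  \sum_(F : {set {set G}} | F \subset edges G)
     indetX K ^+ cc (restrict F) * indetY K ^+ #|F|.

(* Both exponents are truncated subtractions of naturals, but the truncation
   never occurs since cc (restrict F) >= cc G and
   cc (restrict F) + #|F| >= #|G|. *)
Definition tutte (G : graph) : {poly {poly K}} :=
  \sum_(F : {set {set G}} | F \subset edges G)
     (indetX K - 1) ^+ (cc (restrict F) - cc G) *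
     (indetY K - 1) ^+ (cc (restrict F) + #|F| - #|G|).

Definition phi0 (G : graph) : {poly K} := 'X^#|G|.

End Polynomials.

Definition proper (G : graph) (k : nat) (f : {ffun G -> 'I_k}) : bool :=
  [forall x, forall y, adj x y ==> (f x != f y)].

Definition nb_colorings (G : graph) (k : nat) : nat :=
  #|[set f : {ffun G -> 'I_k} | proper f]|.

Definition is_chromatic_poly (K : fieldType) (G : graph) (P : {poly K}) :=
  forall k : nat, P.[k%:R] = (nb_colorings G k)%:R.

(* Existence: a coloring with k colors amounts to the set of colors that it
   uses together with a surjective coloring onto that set. *)
Definition onto_colorings (G : graph) (j : nat) : {set {ffun G -> 'I_j}} :=
  [set f | proper f & f @: [set: G] == [set: 'I_j]].

Lemma onto_colorings_card (G : graph) k (S : {set 'I_k}) :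
  #|[set f : {ffun G -> 'I_k} | proper f & f @: [set: G] == S]|
  = #|onto_colorings G #|S| |.
Proof.
pose h (g : {ffun G -> 'I_#|S|}) : {ffun G -> 'I_k} :=
  [ffun x => enum_val (g x)].
have h_inj : injective h.
  move=> g1 g2 /ffunP eqh; apply/ffunP=> x.
  by apply: enum_val_inj; have:= eqh x; rewrite !ffunE.
rewrite -(card_imset _ h_inj); apply: eq_card => f; rewrite inE.
apply/andP/imsetP => [[pf /eqP fS]|[g]].
  have Sf x : f x \in S by rewrite -fS imset_f ?inE.
  pose g := [ffun x => enum_rank_in (Sf x) (f x)].
  have gK x : enum_val (g x) = f x by rewrite ffunE enum_rankK_in.
  exists g; last by apply/ffunP=> x; rewrite ffunE gK.
  rewrite inE; apply/andP; split.
    apply/forallP=> x; apply/forallP=> y; apply/implyP=> xy.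
    have:= implyP (forallP (forallP pf x) y) xy.
    by rewrite -!gK; apply: contra => /eqP->.
  rewrite eqEsubset subsetT; apply/subsetP=> i _.
  have: enum_val i \in f @: setT by rewrite fS enum_valP.
  case/imsetP=> x _; rewrite -gK => /enum_val_inj ->.
  by rewrite imset_f ?inE.
rewrite inE => /andP[pg /eqP gT] ->; split.
  apply/forallP=> x; apply/forallP=> y; apply/implyP=> xy.
  rewrite !ffunE (inj_eq enum_val_inj).
  exact: (implyP (forallP (forallP pg x) y) xy).
apply/eqP/setP=> i; apply/imsetP/idP => [[x _ ->]|iS].
  by rewrite ffunE enum_valP.
have: enum_rank_in iS i \in g @: setT by rewrite gT inE.
by case/imsetP=> x _ eqi; exists x; rewrite ?inE // ffunE -eqi enum_rankK_in.
Qed.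

Lemma onto_colorings_large (G : graph) j :
  (#|G| < j)%N -> #|onto_colorings G j| = 0%N.
Proof.
move=> ltGj; apply: eq_card0 => f; rewrite !inE; apply/negP=> /andP[_ /eqP fT].
by have:= leq_imset_card f [set: G]; rewrite fT !cardsT card_ord leqNgt ltGj.
Qed.

Lemma nb_coloringsE (G : graph) k :
  nb_colorings G k = (\sum_(j < #|G|.+1) #|onto_colorings G j| * 'C(k, j))%N.
Proof.
pose I (f : {ffun G -> 'I_k}) := f @: [set: G].
have ->: nb_colorings G k = (\sum_(S : {set 'I_k}) #|onto_colorings G #|S| |)%N.
  rewrite /nb_colorings -sum1_card (partition_big I xpredT) //=.
  apply: eq_bigr => S _; rewrite -onto_colorings_card -sum1_card.
  by apply: eq_bigl => f; rewrite !inE.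
have small (S : {set 'I_k}) : (k >= #|S|)%N.
  by rewrite -[k in (_ <= k)%N]card_ord max_card.
pose m := maxn k #|G|.
have lem (S : {set 'I_k}) : (#|S| < m.+1)%N.
  by rewrite ltnS (leq_trans (small S)) ?leq_maxl.
rewrite (partition_big (fun S => Ordinal (lem S)) xpredT) //=.
rewrite (big_ord_widen m.+1 (fun j => #|onto_colorings G j| * 'C(k, j))%N);
  last by rewrite ltnS leq_maxr.
rewrite big_mkcond [RHS]big_mkcond /=; apply: eq_bigr => j _.
rewrite (eq_bigr (fun=> #|onto_colorings G j|)); last by move=> S /eqP <-.
rewrite sum_nat_const mulnC; case: ltnP => [_|/onto_colorings_large -> //].
congr (_ * _)%N; have := card_draws 'I_k j; rewrite card_ord => <-.
by apply: eq_card => S; rewrite !inE.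
Qed.

Section Chromatic.
Variables (K : fieldType) (charK : [pchar K] =i pred0).

Lemma chromatic_poly_exists (G : graph) :
  {P : {poly K} | is_chromatic_poly G P}.
Proof.
exists (\sum_(j < #|G|.+1) #|onto_colorings G j|%:R *:
  (j`!%:R^-1 *: \prod_(i < j) ('X - i%:R%:P))) => k.
rewrite nb_coloringsE horner_sum natr_sum; apply: eq_bigr => j _.
rewrite !hornerZ natrM; congr (_ * _).
have fj : j`!%:R != 0 :> K by rewrite ((pcharf0P K).1 charK) -lt0n fact_gt0.
apply: (mulfI fj); rewrite mulrA divff // mul1r -natrM mulnC bin_ffact.
elim: (nat_of_ord j) => [|i IHi]; first by rewrite big_ord0 ffactn0 hornerC.
rewrite ffactnSr natrM big_ord_recr hornerM /= IHi !hornerE.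
case: (leqP i k) => [leik|ltki]; first by rewrite natrB.
by rewrite ffact_small // !mul0r.
Qed.

Lemma chromatic_poly_unique (G : graph) (P Q : {poly K}) :
  is_chromatic_poly G P -> is_chromatic_poly G Q -> P = Q.
Proof.
move=> hP hQ; apply/eqP; rewrite -subr_eq0; apply: contraT => nz.
pose s : seq K := [seq k%:R | k <- iota 0 (size (P - Q))].
have := max_poly_roots nz (rs := s); rewrite size_map size_iota ltnn; apply.
  by apply/allP=> _ /mapP[k _ ->]; rewrite /root !hornerE hP hQ subrr.
rewrite map_inj_uniq ?iota_uniq // => m n /eqP.
wlog lemn: m n / (m <= n)%N => [hw|].
  by case/orP: (leq_total m n) => /hw // h eqmn; apply/esym/h; rewrite eq_sym.
rewrite eq_sym -subr_eq0 -natrB // ((pcharf0P K).1 charK) subn_eq0 => lenm.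
by apply/eqP; rewrite eqn_leq lemn.
Qed.

(* The polynomial with the prescribed values, by chromatic_poly_unique. *)
Definition phi_chr (G : graph) : {poly K} := sval (chromatic_poly_exists G).

Lemma phi_chrP (G : graph) : is_chromatic_poly G (phi_chr G).
Proof. exact: svalP (chromatic_poly_exists G). Qed.

End Chromatic.

(* Main.v *)
Require Import Defs.
From mathcomp Require Import all_boot all_order all_algebra.

Set Implicit Arguments.
Unset Strict Implicit.
Unset Printing Implicit Defensive.

Import GRing.Theory.
Local Open Scope ring_scope.

(** The whole proof rests on one count ([card_cc_colorings]): the maps from
the vertices of a graph to a set of [c] colors under which every edge is
monochromatic are the maps that are constant on connected components, so there
are [c ^ cc G] of them.

At [X = k], the coefficient [k ^ cc (restrict F)] of [Z_G(k, -1)] therefore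
counts the [k]-colorings under which all the edges of [F] are monochromatic.
Exchanging the two sums, each coloring [f] contributes the sum of [(-1)^|F|]
over the sets [F] of [f]-monochromatic edges, which is the expansion of the
product of [1 - [e is f-monochromatic]] over the edges [e], that is, [1] if [f]
is proper and [0] otherwise. So [Z_G(X, -1)] is the chromatic polynomial.
In [Z_G(X, 0)] only the empty [F] survives, and the graph without edges has
[|V(G)|] components.

The Tutte formula is then a comparison of signs term by term, once the exponents
[cc F - cc G] and [cc F + |F| - |V(G)|] are known to be nonnegative. Both
inequalities follow from the same count with two colors. Having fewer edges
leaves more colorings with monochromatic edges, whence [cc G <= cc F]. And two
2-colorings with the same bichromatic edges differ, modulo 2, by a coloring
with monochromatic edges only, so at most [2 ^ cc G] colorings share a given set
of bichromatic edges; whence [2 ^ |V(G)| <= 2 ^ |E(G)| * 2 ^ cc G]. *)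

(** * Colorings with monochromatic edges *)

(** [f] is constant on [e]. *)
Definition monochrome (T : finType) (C : eqType) (f : T -> C) (e : {set T}) :=
  [forall x in e, forall y in e, f x == f y].

Lemma monochrome_pair (T : finType) (C : eqType) (f : T -> C) x y :
  monochrome f [set x; y] = (f x == f y).
Proof.
apply/idP/idP => [/forall_inP/(_ x (set21 _ _))/forall_inP|/eqP fxy].
  by apply; rewrite set22.
apply/forall_inP=> u /set2P uxy; apply/forall_inP=> v /set2P vxy.
by case: uxy => ->; case: vxy => ->; rewrite ?fxy.
Qed.

(** The colorings under which every edge of [F] is monochromatic. *)
Definition mono_colorings (T C : finType) (F : {set {set T}}) :
  {set {ffun T -> C}} := [set f : {ffun T -> C} | [forall e in F, monochrome f e]].

Lemma edgeP (G : graph) e : e \in edges G -> exists x y, e = [set x; y].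
Proof. by move/edges_card2/eqP/cards2P=> [x [y [_ ->]]]; exists x, y. Qed.

Lemma adj_connect_sym (G : graph) : connect_sym (@adj G).
Proof. by apply: sym_connect_sym => x y; rewrite /adj setUC. Qed.

Lemma mono_coloringsP (G : graph) (C : finType) (f : {ffun G -> C}) :
  reflect (forall x, f x = f (fingraph.root (@adj G) x))
          (f \in mono_colorings C (edges G)).
Proof.
rewrite inE; apply: (iffP forall_inP) => [fE x|fR e Ee].
  have closed_fx : closed (@adj G) [pred z | f z == f x].
    by move=> u v /fE; rewrite monochrome_pair !inE => /eqP->.
  have := closed_connect closed_fx (connect_root (@adj G) x).
  by rewrite !inE eqxx => /esym/eqP.
have [x [y def_e]] := edgeP Ee; rewrite def_e monochrome_pair fR (fR y).
suff /eqP->: fingraph.root (@adj G) x == fingraph.root (@adj G) y by [].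
by rewrite root_connect ?connect1 /adj -?def_e //; apply: adj_connect_sym.
Qed.

Lemma card_cc_colorings (G : graph) (C : finType) :
  #|mono_colorings C (edges G)| = (#|C| ^ cc G)%N.
Proof.
have symG := @adj_connect_sym G.
pose R := {x | roots (@adj G) x}.
pose rt x : R := Sub (fingraph.root (@adj G) x) (fingraph.roots_root symG x).
pose h (g : {ffun R -> C}) : {ffun G -> C} := [ffun x => g (rt x)].
have rtK (r : R) : rt (val r) = r.
  by apply: val_inj; apply/eqP; apply: (valP r).
have h_inj : injective h.
  move=> g1 g2 /ffunP eqh; apply/ffunP=> r.
  by have := eqh (val r); rewrite !ffunE rtK.
have -> : cc G = #|{: R}|.
  by rewrite card_sig; apply: eq_card => x; rewrite !inE andbT.
rewrite -card_ffun -(card_imset _ h_inj).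
apply: eq_card => f; apply/mono_coloringsP/imsetP => [fR|[g _ ->] x].
  by exists [ffun r : R => f (val r)] => //; apply/ffunP=> x; rewrite !ffunE.
by rewrite !ffunE; congr (g _); apply: val_inj; rewrite /= root_root.
Qed.

Lemma edges_restrict (G : graph) (F : {set {set G}}) :
  F \subset edges G -> edges (restrict F) = F.
Proof. by move=> sFE; apply/setIidPr. Qed.

Lemma card_mono_colorings (G : graph) (C : finType) (F : {set {set G}}) :
  F \subset edges G -> #|mono_colorings C F| = (#|C| ^ cc (restrict F))%N.
Proof. by move=> sFE; rewrite -card_cc_colorings edges_restrict. Qed.

(** * Bounds on the number of components *)

Lemma cc_restrict_ge (G : graph) (F : {set {set G}}) :
  F \subset edges G -> (cc G <= cc (restrict F))%N.
Proof.
move=> sFE; rewrite -(@leq_exp2l 2) // -card_bool.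
rewrite -card_cc_colorings -card_mono_colorings //.
apply: subset_leq_card; apply/subsetP=> f; rewrite !inE => /forall_inP fE.
by apply/forall_inP=> e /(subsetP sFE)/fE.
Qed.

Lemma card_vertex_le (G : graph) : (#|G| <= cc G + #|edges G|)%N.
Proof.
rewrite -(@leq_exp2l 2) // -{1}card_bool -card_ffun.
pose bi (f : {ffun G -> bool}) := [set e in edges G | ~~ monochrome f e].
rewrite -[leqLHS]sum1_card (partition_big bi [in powerset (edges G)]) /=; last first.
  by move=> f _; rewrite inE; apply/subsetP=> e; rewrite inE => /andP[].
rewrite expnD mulnC -card_powerset -sum_nat_const leq_sum // => B _.
rewrite sum1_card; case: (pickP [pred f | bi f == B]) => [f0|none].
  move=> /eqP bi_f0; rewrite -card_bool -card_cc_colorings.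
  (* Adding [f0] modulo 2 sends the fibre of [f0] into [mono_colorings]. *)
  pose t (f : {ffun G -> bool}) : {ffun G -> bool} := [ffun x => f x (+) f0 x].
  have t_inj : injective t.
    move=> f g /ffunP eq_t; apply/ffunP=> x.
    by have := eq_t x; rewrite !ffunE => /addIb.
  rewrite -(card_imset _ t_inj); apply: subset_leq_card.
  apply/subsetP=> _ /imsetP[f fib_f ->]; rewrite inE.
  have bi_f : bi f = B by apply/eqP.
  apply/forall_inP=> e Ee; have /setP/(_ e) := etrans bi_f (esym bi_f0).
  rewrite !inE Ee /=; have [x [y ->]] := edgeP Ee.
  rewrite !monochrome_pair !ffunE.
  by case: (f x) (f y) (f0 x) (f0 y) => [] [] [] [].
by rewrite eq_card0.
Qed.

Lemma card_vertex_le_restrict (G : graph) (F : {set {set G}}) :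
  F \subset edges G -> (#|G| <= cc (restrict F) + #|F|)%N.
Proof.
by move=> sFE; have := card_vertex_le (restrict F); rewrite edges_restrict.
Qed.

Lemma cc_restrict0 (G : graph) : cc (restrict (set0 : {set {set G}})) = #|G|.
Proof.
apply/eqP; rewrite -(@eqn_exp2l 2) // -card_bool.
rewrite -card_mono_colorings ?sub0set // -card_ffun; apply/eqP.
by apply: eq_card => f; rewrite !inE; apply/forall_inP=> e; rewrite inE.
Qed.

(** * Substitution in the two polynomials *)

Section Substitution.
Variables (K : fieldType) (G : graph) (a b : {poly K}).

Lemma subst2_sum (I : finType) (P : pred I) (F : I -> {poly {poly K}}) :
  subst2 (\sum_(i | P i) F i) a b = \sum_(i | P i) subst2 (F i) a b.
Proof.
rewrite /subst2 -/(comp_poly a).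
by rewrite (rmorph_sum (map_poly (comp_poly a))) horner_sum.
Qed.

Lemma subst2_fortuin_kasteleyn :
  subst2 (fortuin_kasteleyn K G) a b =
  \sum_(F : {set {set G}} | F \subset edges G) a ^+ cc (restrict F) * b ^+ #|F|.
Proof.
rewrite subst2_sum; apply: eq_bigr => F _; rewrite /subst2 /indetX /indetY.
rewrite (rmorphM (map_poly (comp_poly a))) !(rmorphXn (map_poly (comp_poly a))).
by rewrite /= map_polyC map_polyX /= comp_polyX !hornerE.
Qed.

Lemma subst2_tutte :
  subst2 (tutte K G) a b =
  \sum_(F : {set {set G}} | F \subset edges G)
     (a - 1) ^+ (cc (restrict F) - cc G) *
     (b - 1) ^+ (cc (restrict F) + #|F| - #|G|).
Proof.
rewrite subst2_sum; apply: eq_bigr => F _; rewrite /subst2 /indetX /indetY.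
rewrite (rmorphM (map_poly (comp_poly a))) !(rmorphXn (map_poly (comp_poly a))).
rewrite !(rmorphB (map_poly (comp_poly a))) (rmorph1 (map_poly (comp_poly a))).
by rewrite /= map_polyC map_polyX /= comp_polyX !hornerE.
Qed.

End Substitution.

(** * The three evaluations *)

Lemma proper_monochrome (G : graph) k (f : {ffun G -> 'I_k}) :
  Defs.proper f = [forall e in edges G, ~~ monochrome f e].
Proof.
apply/forallP/forall_inP => [pf e Ee|nmono x].
  have [x [y def_e]] := edgeP Ee; rewrite def_e monochrome_pair.
  by have /forallP/(_ y)/implyP := pf x; apply; rewrite /adj -def_e.
by apply/forallP=> y; apply/implyP=> /nmono; rewrite monochrome_pair.
Qed.

(** The product of the [1 - [e is monochromatic]] over the edges, expanded. *)
Lemma proper_inclusion_exclusion (R : comNzRingType) (G : graph) k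
    (f : {ffun G -> 'I_k}) :
  (Defs.proper f)%:R = \sum_(F : {set {set G}} | F \subset edges G)
     (f \in mono_colorings _ F)%:R * (-1) ^+ #|F| :> R.
Proof.
have -> : (Defs.proper f)%:R = \prod_(e : {set G})
    ((if (e \in edges G) && monochrome f e then -1 else 0) + 1) :> R.
  rewrite proper_monochrome; case: forall_inP => [nmono|].
    rewrite big1 // => e _; case: ifP => [/andP[/nmono/negPf->] //|_].
    by rewrite add0r.
  move/forall_inP; rewrite negb_forall => /existsP[e].
  rewrite negb_imply negbK => mono_e.
  by rewrite (bigD1 e) //= mono_e addNr mul0r.
rewrite bigA_distr [RHS]big_mkcond /=; apply: eq_bigr => F _.
rewrite -big_mkcond /=.
case: (boolP ((F \subset edges G) && (f \in mono_colorings _ F))).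
  case/andP=> sFE fF; rewrite sFE fF mul1r (eq_bigr (fun=> -1)) ?prodr_const //.
  move: fF; rewrite inE => /forall_inP fF e Fe.
  by rewrite (subsetP sFE) // fF.
move=> nF; transitivity (0 : R); last first.
  by move: nF; case: (F \subset _); case: (f \in _); rewrite ?mul0r.
have [e Fe /negPf ne] :
  exists2 e, e \in F & ~~ ((e \in edges G) && monochrome f e).
  apply/exists_inP; apply: contraR nF; rewrite negb_exists => /forallP all_e.
  have {}all_e e : e \in F -> (e \in edges G) && monochrome f e.
    by move=> Fe; have := all_e e; rewrite Fe negbK.
  rewrite inE; apply/andP; split.
    by apply/subsetP=> e /all_e/andP[].
  by apply/forall_inP=> e /all_e/andP[].
by rewrite (bigD1 e) //= ne mul0r.
Qed.

Lemma fortuin_kasteleyn_chromatic (K : fieldType) (G : graph) :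
  is_chromatic_poly G (subst2 (fortuin_kasteleyn K G) 'X (-1)).
Proof.
move=> k; rewrite subst2_fortuin_kasteleyn horner_sum.
rewrite /nb_colorings -sum1_card natr_sum [RHS]big_mkcond /=.
rewrite [RHS](eq_bigr (fun f => \sum_(F : {set {set G}} | F \subset edges G)
    (f \in mono_colorings _ F)%:R * (-1) ^+ #|F|)); last first.
  by move=> f _; rewrite -proper_inclusion_exclusion inE; case: (Defs.proper f).
rewrite exchange_big /=; apply: eq_bigr => F sFE.
rewrite -mulr_suml -natr_sum -big_mkcond /= sum1_card card_mono_colorings //.
by rewrite card_ord natrX !hornerE.
Qed.

Lemma fortuin_kasteleyn0 (K : fieldType) (G : graph) :
  subst2 (fortuin_kasteleyn K G) 'X 0 = phi0 K G.
Proof.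
rewrite subst2_fortuin_kasteleyn (bigD1 set0) ?sub0set //= big1 => [|F].
  by rewrite cards0 cc_restrict0 mulr1 addr0.
by case/andP=> _ nzF; rewrite expr0n cards_eq0 (negPf nzF) mulr0.
Qed.

Lemma fortuin_kasteleyn_tutte (K : fieldType) (G : graph) :
  subst2 (fortuin_kasteleyn K G) 'X (-1) =
  (-1) ^+ (#|G| + cc G) * 'X ^+ cc G * subst2 (tutte K G) (1 - 'X) 0.
Proof.
rewrite subst2_fortuin_kasteleyn subst2_tutte mulr_sumr.
apply: eq_bigr => F sFE.
have [i def_i] : exists i, cc (restrict F) = (cc G + i)%N.
  by exists (cc (restrict F) - cc G)%N; rewrite subnKC // cc_restrict_ge.
have [j def_j] : exists j, (cc (restrict F) + #|F|)%N = (#|G| + j)%N.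
  exists (cc (restrict F) + #|F| - #|G|)%N.
  by rewrite subnKC // card_vertex_le_restrict.
rewrite def_j def_i !addKn addrAC subrr !add0r (exprNn 'X).
(* Modulo 2, [#|F|] is [#|G| + cc G + i + j]. *)
have -> : (-1) ^+ #|F| =
    (-1) ^+ (#|G| + cc G) * (-1) ^+ i * (-1) ^+ j :> {poly K}.
  rewrite -!exprD -signr_odd -[RHS]signr_odd; congr (_ ^+ nat_of_bool _).
  have := congr1 odd def_j; rewrite def_i !oddD.
  by do 5!case: odd.
by rewrite exprD [LHS](AC (2*3) (3*1*(4*2*5))).
Qed.

Theorem proposition2p14 (K : fieldType) (charK : [pchar K] =i pred0)
    (G : graph) :
  [/\ subst2 (fortuin_kasteleyn K G) 'X (-1) = phi_chr charK G,
      subst2 (fortuin_kasteleyn K G) 'X 0 = phi0 K G &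
      phi_chr charK G =
        (-1) ^+ (#|G| + cc G) * 'X ^+ cc G * subst2 (tutte K G) (1 - 'X) 0].
Proof.
have Z_chr : subst2 (fortuin_kasteleyn K G) 'X (-1) = phi_chr charK G.
  apply: chromatic_poly_unique charK _ _ _ _ (phi_chrP charK G).
  exact: fortuin_kasteleyn_chromatic.
by split; rewrite -?Z_chr ?fortuin_kasteleyn0 ?fortuin_kasteleyn_tutte.
Qed.
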